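(* Let $[g]\in \mathrm{PSL}(3,\mathbb{H})$, where $g$ is a lift of $[g]$ in $\mathrm{SL}(3,\mathbb{H})$. Let $\Phi(g)\in \mathrm{SL}(6,\mathbb{C})$ be the complex adjoint of $g$, and let $\chi_{\Phi(g)}$ be its characteristic polynomial, given by $$\chi_{\Phi(g)}=x^6-c_5x^5+c_4x^4-c_3x^3+c_2x^2-c_1x+1,$$ where all the coefficients are real numbers. Then $g$ is reversible in $\mathrm{SL}(3,\mathbb{H})$ if and only if $c_5=c_1$ and $c_4=c_2$.
   Context: $\mathbb{H}$ denotes Hamilton's real quaternions. For $A\in \mathrm{M}(3,\mathbb{H})$ write $A=A_1+A_2\mathbf{j}$ with $A_1,A_2\in \mathrm{M}(3,\mathbb{C})$, and let $\Phi(A)=\begin{pmatrix} A_1 & A_2\\ -\overline{A_2} & \overline{A_1}\end{pmatrix}\in \mathrm{M}(6,\mathbb{C})$ be its complex adjoint. Put $\det_{\mathbb{H}}(A):=\det(\Phi(A))$, $\mathrm{SL}(3,\mathbb{H})=\{g\in \mathrm{M}(3,\mathbb{H}) : \det_{\mathbb{H}}(g)=1\}$ and $\mathrm{PSL}(3,\mathbb{H})=\mathrm{SL}(3,\mathbb{H})/\{\pm \mathrm{I}_3\}$. An element $g$ of a group $G$ is called reversible in $G$ if it is conjugate to $g^{-1}$ in $G$. *)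

(* Defs.v *)
From HB Require Import structures.
From mathcomp Require Import all_boot all_order all_algebra.
From mathcomp Require Import generic_quotient ring.
From mathcomp Require Import complex reals.

Set Implicit Arguments.
Unset Strict Implicit.
Unset Printing Implicit Defensive.

Import GRing.Theory.

Local Open Scope ring_scope.
Local Open Scope quotient_scope.

Definition reversible (G : groupType) (g : G) : Prop :=
  exists h : G, (g ^ h = g^-1)%g.

(* [Quat a b c d] is a + b i + c j + d k. *)
Record quat (R : Type) : Type := Quat { qr : R; qi : R; qj : R; qk : R }.

Section QuatChoice.
Variable R : Type.
Definition tuple_of_quat (x : quat R) := (qr x, qi x, qj x, qk x).
Definition quat_of_tuple (t : R * R * R * R) :=
  let: (a, b, c, d) := t in Quat a b c d.
Lemma tuple_of_quatK : cancel tuple_of_quat quat_of_tuple.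
Proof. by case. Qed.
End QuatChoice.

HB.instance Definition _ (R : eqType) := Equality.copy (quat R)
  (can_type (@tuple_of_quatK R)).
HB.instance Definition _ (R : choiceType) := Choice.copy (quat R)
  (can_type (@tuple_of_quatK R)).

Section QuatRing.
Variable R : comNzRingType.
Local Notation H := (quat R).

Definition addq (x y : H) : H :=
  Quat (qr x + qr y) (qi x + qi y) (qj x + qj y) (qk x + qk y).
Definition oppq (x : H) : H := Quat (- qr x) (- qi x) (- qj x) (- qk x).
Definition mulq (x y : H) : H :=
  Quat (qr x * qr y - qi x * qi y - qj x * qj y - qk x * qk y)
       (qr x * qi y + qi x * qr y + qj x * qk y - qk x * qj y)
       (qr x * qj y - qi x * qk y + qj x * qr y + qk x * qi y)
       (qr x * qk y + qi x * qj y - qj x * qi y + qk x * qr y).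

Fact addqA : associative addq.
Proof. by move=> [? ? ? ?] [? ? ? ?] [? ? ? ?]; rewrite /addq /= !addrA. Qed.
Fact addqC : commutative addq.
Proof. by move=> x y; congr Quat; exact: addrC. Qed.
Fact add0q : left_id (Quat 0 0 0 0) addq.
Proof. by move=> [? ? ? ?]; rewrite /addq /= !add0r. Qed.
Fact addNq : left_inverse (Quat 0 0 0 0) oppq addq.
Proof. by move=> [? ? ? ?]; rewrite /addq /= !addNr. Qed.
Fact mulqA : associative mulq.
Proof. by move=> [? ? ? ?] [? ? ? ?] [? ? ? ?]; congr Quat => /=; ring. Qed.
Fact mul1q : left_id (Quat 1 0 0 0) mulq.
Proof. by move=> [? ? ? ?]; congr Quat => /=; ring. Qed.
Fact mulq1 : right_id (Quat 1 0 0 0) mulq.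
Proof. by move=> [? ? ? ?]; congr Quat => /=; ring. Qed.
Fact mulqDl : left_distributive mulq addq.
Proof. by move=> [? ? ? ?] [? ? ? ?] [? ? ? ?]; congr Quat => /=; ring. Qed.
Fact mulqDr : right_distributive mulq addq.
Proof. by move=> [? ? ? ?] [? ? ? ?] [? ? ? ?]; congr Quat => /=; ring. Qed.
Fact oneq_neq0 : Quat 1 0 0 0 != Quat 0 0 0 0 :> H.
Proof. by apply/eqP => -[] /eqP; rewrite oner_eq0. Qed.

HB.instance Definition _ := GRing.isNzRing.Build H
  addqA addqC add0q addNq mulqA mul1q mulq1 mulqDl mulqDr oneq_neq0.

Definition iq : H := Quat 0 1 0 0.
Definition jq : H := Quat 0 0 1 0.
Definition kq : H := Quat 0 0 0 1.

Lemma hamilton :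
  [/\ iq ^+ 2 = -1, jq ^+ 2 = -1, kq ^+ 2 = -1 & iq * jq * kq = -1].
Proof. by split; congr Quat => /=; ring. Qed.

End QuatRing.

Section ComplexAdjoint.
Variable R : rcfType.
Local Notation H := (quat R).
Local Notation C := R[i].

(* a + b i + c j + d k = (a + b i) + (c + d i) j *)
Definition cpart1 (q : H) : C := Complex (qr q) (qi q).
Definition cpart2 (q : H) : C := Complex (qj q) (qk q).
Definition quat_of_complex (z : C) : H := Quat (Re z) (Im z) 0 0.

Lemma cpartE q :
  q = quat_of_complex (cpart1 q) + quat_of_complex (cpart2 q) * jq R.
Proof. by case: q => a b c d; congr Quat => /=; ring. Qed.

Definition Phi n (A : 'M[H]_n) : 'M[C]_(n + n) :=
  let A1 := map_mx cpart1 A in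
  let A2 := map_mx cpart2 A in
  block_mx A1 A2 (- map_mx conjc A2) (map_mx conjc A1).

Definition detH n (A : 'M[H]_n) : C := \det (Phi A).

Lemma cpart1_is_additive : zmod_morphism cpart1. Proof. by []. Qed.
Lemma cpart2_is_additive : zmod_morphism cpart2. Proof. by []. Qed.
HB.instance Definition _ := GRing.isZmodMorphism.Build H C cpart1 cpart1_is_additive.
HB.instance Definition _ := GRing.isZmodMorphism.Build H C cpart2 cpart2_is_additive.

Lemma cpart1M (x y : H) :
  cpart1 (x * y) = cpart1 x * cpart1 y - cpart2 x * conjc (cpart2 y).
Proof.
by case: x y => [a b c d] [e f g h]; congr Complex => /=; ring.
Qed.

Lemma cpart2M (x y : H) :
  cpart2 (x * y) = cpart1 x * cpart2 y + cpart2 x * conjc (cpart1 y).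
Proof.
by case: x y => [a b c d] [e f g h]; congr Complex => /=; ring.
Qed.

Lemma map_cpart1M n (A B : 'M[H]_n) :
  map_mx cpart1 (A *m B) = map_mx cpart1 A *m map_mx cpart1 B
    - map_mx cpart2 A *m map_mx conjc (map_mx cpart2 B).
Proof.
apply/matrixP => i j; rewrite !mxE raddf_sum -sumrB /=.
by apply: eq_bigr => k _; rewrite !mxE cpart1M.
Qed.

Lemma map_cpart2M n (A B : 'M[H]_n) :
  map_mx cpart2 (A *m B) = map_mx cpart1 A *m map_mx cpart2 B
    + map_mx cpart2 A *m map_mx conjc (map_mx cpart1 B).
Proof.
apply/matrixP => i j; rewrite !mxE raddf_sum -big_split /=.
by apply: eq_bigr => k _; rewrite !mxE cpart2M.
Qed.

Lemma map_conjcK m n (A : 'M[C]_(m, n)) : map_mx conjc (map_mx conjc A) = A.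
Proof. by apply/matrixP => i j; rewrite !mxE conjcK. Qed.

Lemma PhiM n (A B : 'M[H]_n) : Phi (A *m B) = Phi A *m Phi B.
Proof.
rewrite /Phi mulmx_block map_cpart1M map_cpart2M !map_mxB !map_mxD !map_mxM /=.
rewrite !map_conjcK !mulmxN !mulNmx opprD.
by congr block_mx; rewrite addrC.
Qed.

Lemma Phi1 n : Phi (1%:M : 'M[H]_n) = 1%:M.
Proof.
have e1 : map_mx cpart1 (1%:M : 'M[H]_n) = 1%:M.
  by apply/matrixP => i j; rewrite !mxE; case: (i == j).
have e2 : map_mx cpart2 (1%:M : 'M[H]_n) = 0.
  by apply/matrixP => i j; rewrite !mxE; case: (i == j).
by rewrite /Phi e1 e2 map_mx0 oppr0 map_mx1 -scalar_mx_block.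
Qed.

Lemma PhiN n (A : 'M[H]_n) : Phi (- A) = - Phi A.
Proof. by rewrite /Phi opp_block_mx !map_mxN. Qed.

Lemma Phi_inj n : injective (@Phi n).
Proof.
move=> A B /eq_block_mx[/matrixP e1 /matrixP e2 _ _].
apply/matrixP => i j; rewrite [LHS]cpartE [RHS]cpartE.
by move: (e1 i j) (e2 i j); rewrite !mxE => -> ->.
Qed.

Definition quat_of_pair (z w : C) : H :=
  quat_of_complex z + quat_of_complex w * jq R.

Lemma quat_of_pairK1 z w : cpart1 (quat_of_pair z w) = z.
Proof. by case: z w => [a b] [c d]; congr Complex => /=; ring. Qed.

Lemma quat_of_pairK2 z w : cpart2 (quat_of_pair z w) = w.
Proof. by case: z w => [a b] [c d]; congr Complex => /=; ring. Qed.

Definition Phi_inv n (M : 'M[C]_(n + n)) : 'M[H]_n :=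
  \matrix_(i, j) quat_of_pair (ulsubmx M i j) (ursubmx M i j).

Lemma PhiK n : cancel (@Phi n) (@Phi_inv n).
Proof.
move=> A; apply/matrixP => i j.
by rewrite mxE block_mxKul block_mxKur !mxE [RHS]cpartE.
Qed.

(* The image of [Phi] is the set of M such that J * conj(M) = M * J, which is
   stable under inversion. *)
Definition Jmx n : 'M[C]_(n + n) := block_mx 0 1%:M (- 1%:M) 0.

Lemma Phi_J n (A : 'M[H]_n) :
  Jmx n *m map_mx conjc (Phi A) = Phi A *m Jmx n.
Proof.
rewrite /Jmx /Phi map_block_mx !mulmx_block !mul0mx !mulmx0 !add0r !addr0.
by rewrite !mulNmx !mulmxN !mul1mx !mulmx1 map_mxN !map_conjcK.
Qed.

Lemma Phi_invK n (M : 'M[C]_(n + n)) :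
  Jmx n *m map_mx conjc M = M *m Jmx n -> Phi (Phi_inv M) = M.
Proof.
have eul : map_mx cpart1 (Phi_inv M) = ulsubmx M.
  by apply/matrixP => i j; rewrite mxE mxE quat_of_pairK1.
have eur : map_mx cpart2 (Phi_inv M) = ursubmx M.
  by apply/matrixP => i j; rewrite mxE mxE quat_of_pairK2.
rewrite /Phi eul eur -{1 2}[M]submxK /Jmx map_block_mx !mulmx_block.
rewrite !mul0mx !mulmx0 !add0r !addr0 !mulNmx !mulmxN !mul1mx !mulmx1.
move=> /eq_block_mx[_ _ e1 e2]; rewrite -[RHS]submxK; congr block_mx.
  by rewrite -e2.
by rewrite -[LHS]opprK e1 opprK.
Qed.

Lemma Phi_inv_unit n (A : 'M[H]_n) :
  Phi A \in unitmx -> Phi (Phi_inv (invmx (Phi A))) = invmx (Phi A).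
Proof.
move=> uA; apply: Phi_invK.
have uA' : map_mx conjc (Phi A) \in unitmx by rewrite map_unitmx.
rewrite map_invmx -[LHS](mulKmx uA) (mulmxA (Phi A)) -Phi_J -(mulmxA (Jmx n)) mulmxV //.
by rewrite mulmx1.
Qed.

Lemma detH1 n : detH (1%:M : 'M[H]_n) = 1.
Proof. by rewrite /detH Phi1 det1. Qed.

Lemma detHM n (A B : 'M[H]_n) : detH (A *m B) = detH A * detH B.
Proof. by rewrite /detH PhiM det_mulmx. Qed.

Section SL.
Variable n : nat.

Definition SL_pred : pred 'M[H]_n := fun A => detH A == 1.
Record SL : Type := MkSL { SL_val :> 'M[H]_n; SL_valP : SL_pred SL_val }.

HB.instance Definition _ := [isSub for SL_val].
HB.instance Definition _ := [Choice of SL by <:].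

Lemma SL_unit (g : SL) : Phi g \in unitmx.
Proof. by rewrite unitmxE -/(detH g) (eqP (SL_valP g)) unitr1. Qed.

Fact SL_one_subproof : SL_pred 1%:M. Proof. by rewrite /SL_pred detH1. Qed.
Fact SL_mul_subproof (g h : SL) : SL_pred (g *m h).
Proof.
by rewrite /SL_pred detHM (eqP (SL_valP g)) (eqP (SL_valP h)) mulr1.
Qed.
Fact SL_inv_subproof (g : SL) : SL_pred (Phi_inv (invmx (Phi g))).
Proof.
rewrite /SL_pred /detH Phi_inv_unit ?SL_unit // det_inv -/(detH g).
by rewrite (eqP (SL_valP g)) invr1.
Qed.

Definition SL_one : SL := MkSL SL_one_subproof.
Definition SL_mul (g h : SL) : SL := MkSL (SL_mul_subproof g h).
Definition SL_inv (g : SL) : SL := MkSL (SL_inv_subproof g).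

Fact SL_mulA : associative SL_mul.
Proof. by move=> g h k; apply: val_inj; exact: mulmxA. Qed.
Fact SL_mul1 : left_id SL_one SL_mul.
Proof. by move=> g; apply: val_inj; exact: mul1mx. Qed.
Fact SL_mulr1 : right_id SL_one SL_mul.
Proof. by move=> g; apply: val_inj; exact: mulmx1. Qed.
Fact SL_mulV : left_inverse SL_one SL_inv SL_mul.
Proof.
move=> g; apply/val_inj/Phi_inj.
by rewrite /= PhiM Phi_inv_unit ?SL_unit // mulVmx ?SL_unit // Phi1.
Qed.
Fact SL_mulrV : right_inverse SL_one SL_inv SL_mul.
Proof.
move=> g; apply/val_inj/Phi_inj.
by rewrite /= PhiM Phi_inv_unit ?SL_unit // mulmxV ?SL_unit // Phi1.
Qed.

HB.instance Definition _ := isGroup.Build SL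
  SL_mulA SL_mul1 SL_mulr1 SL_mulV SL_mulrV.

(* [g] and [h] lie in the same coset of {I, -I}. *)
Definition pm_rel (g h : SL) : bool := (val h == val g) || (val h == - val g).

Fact pm_rel_refl : reflexive pm_rel.
Proof. by move=> g; rewrite /pm_rel eqxx. Qed.
Fact pm_rel_sym : symmetric pm_rel.
Proof. by move=> g h; rewrite /pm_rel eq_sym -eqr_oppLR (eq_sym (- _)). Qed.
Fact pm_rel_trans : transitive pm_rel.
Proof.
move=> h g k /orP[]/eqP e1 /orP[]/eqP e2; rewrite /pm_rel;
  by rewrite e2 e1 ?opprK eqxx ?orbT.
Qed.

Canonical pm_equiv := EquivRel pm_rel pm_rel_refl pm_rel_sym pm_rel_trans.

Definition PSL := {eq_quot pm_rel}.
HB.instance Definition _ := Choice.on PSL.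
HB.instance Definition _ := EqQuotient.on PSL.

End SL.

End ComplexAdjoint.

(* Main.v *)
Require Import Defs.
From HB Require Import structures.
From mathcomp Require Import all_boot all_order all_algebra.
From mathcomp Require Import generic_quotient complex reals.
From mathcomp Require Import fingroup perm ring lra.

(* Reversibility of [g] means that [g X g = X] for some [X]; by real scaling
   [X] only has to be invertible, since [detH X >= 0]. Over the quaternions [g]
   is conjugate to a lower triangular matrix with complex diagonal
   [l0, l1, l2], and the characteristic polynomial of [Phi g] is the product of
   the real quadratics [(x - l_i) (x - conj l_i)]. If it is palindromic, the
   classes of the [l_i] are permuted by inversion, and since
   [|l0 l1 l2| = 1], either the moduli [|l_i|] are pairwise distinct or they all
   equal 1. For all [l m], the map [x |-> l x - x m] on the quaternions is
   semisimple, so a unipotent conjugation brings [g] to the form [D + N], where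
   [D] is diagonal, [N] is nilpotent and [D N = N D]. When the moduli are
   distinct, [N = 0] and a monomial matrix does the job. When they are all 1,
   conjugation by [j] sends each [l_i^-1] back to [l_i]; it remains to conjugate
   two nilpotents with the same vanishing pattern inside the commutant of [D],
   which is done by hand for 3 x 3 matrices. *)

Set Implicit Arguments.
Unset Strict Implicit.
Unset Printing Implicit Defensive.

Import Order.TTheory GRing.Theory Num.Theory.

Local Open Scope ring_scope.
Local Open Scope quotient_scope.

(** * The quaternion division ring, intertwiners and the Sylvester equation *)

Section Quaternions.
Variable R : rcfType.
Local Notation H := (quat R).
Implicit Types (x y l m : H).

Definition sqnormq x : R := qr x ^+ 2 + qi x ^+ 2 + qj x ^+ 2 + qk x ^+ 2.
Definition conjq x : H := Quat (qr x) (- qi x) (- qj x) (- qk x).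
Definition realq (a : R) : H := Quat a 0 0 0.

Lemma realqC a x : realq a * x = x * realq a.
Proof. by case: x => *; congr Quat => /=; ring. Qed.

Lemma realqM a b : realq (a * b) = realq a * realq b.
Proof. by congr Quat => /=; ring. Qed.

Lemma mulq_conj x : x * conjq x = realq (sqnormq x).
Proof. by case: x => *; rewrite /sqnormq; congr Quat => /=; ring. Qed.

Lemma mulconjq x : conjq x * x = realq (sqnormq x).
Proof. by case: x => *; rewrite /sqnormq; congr Quat => /=; ring. Qed.

Lemma sqnormqM x y : sqnormq (x * y) = sqnormq x * sqnormq y.
Proof. by case: x y => [????] [????]; rewrite /sqnormq /=; ring. Qed.

Lemma sqnormq_eq0 x : (sqnormq x == 0) = (x == 0).
Proof.
apply/eqP/eqP => [|->]; last by rewrite /sqnormq /=; ring.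
case: x => a b c d; rewrite /sqnormq /= => e.
have [] : [/\ a ^+ 2 = 0, b ^+ 2 = 0, c ^+ 2 = 0 & d ^+ 2 = 0].
  have := (sqr_ge0 a, sqr_ge0 b, sqr_ge0 c, sqr_ge0 d).
  by move=> [[[]]] *; split; lra.
by do 4![move=> /eqP; rewrite sqrf_eq0 => /eqP ->].
Qed.

(* Locked: otherwise [mulrA] reassociates inside [x^-1]. *)
Definition invq x : H := locked (realq (sqnormq x)^-1 * conjq x).

Fact mulVq : {in [pred x : H | x != 0], left_inverse 1 invq *%R}.
Proof.
move=> x /= x0; rewrite /invq -lock -mulrA mulconjq -realqM.
by rewrite mulVf ?sqnormq_eq0.
Qed.
Fact mulqV : {in [pred x : H | x != 0], right_inverse 1 invq *%R}.
Proof.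
move=> x /= x0; rewrite /invq -lock mulrA -realqC -mulrA mulq_conj -realqM.
by rewrite mulVf ?sqnormq_eq0.
Qed.
Fact unitqP x y : y * x = 1 /\ x * y = 1 -> [pred x : H | x != 0] x.
Proof.
move=> [e _] /=; apply: contra_eq_neq e => ->.
by rewrite mulr0 eq_sym oner_neq0.
Qed.
Fact invq_out : {in [predC [pred x : H | x != 0]], invq =1 id}.
Proof.
move=> x; rewrite !inE negbK => /eqP ->.
by rewrite /invq -lock; congr Quat => /=; rewrite ?oppr0 !mulr0; ring.
Qed.

HB.instance Definition _ :=
  GRing.NzRing_hasMulInverse.Build H mulVq mulqV unitqP invq_out.

Lemma unitqE x : (x \is a GRing.unit) = (x != 0). Proof. by []. Qed.

Lemma mulq_eq0 x y : (x * y == 0) = (x == 0) || (y == 0).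
Proof. by rewrite -!sqnormq_eq0 sqnormqM mulf_eq0. Qed.

(** These are the possible [(i, j)] entries of a matrix commuting with a diagonal one, where [l] and
    [m] are the diagonal entries number [i] and [j]. *)
Definition intertwiner l m : pred H := fun x => l * x == x * m.

Lemma intertwinerM l m n x y :
  intertwiner l m x -> intertwiner m n y -> intertwiner l n (x * y).
Proof. by move=> /eqP e1 /eqP e2; apply/eqP; rewrite mulrA e1 -!mulrA e2. Qed.

Lemma intertwinerB l m x y :
  intertwiner l m x -> intertwiner l m y -> intertwiner l m (x - y).
Proof. by move=> /eqP e1 /eqP e2; apply/eqP; rewrite mulrBr mulrBl e1 e2. Qed.

Lemma intertwinerN l m x : intertwiner l m x -> intertwiner l m (- x).
Proof. by move=> /eqP e; apply/eqP; rewrite mulrN mulNr e. Qed.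

Lemma intertwinerD l m x y :
  intertwiner l m x -> intertwiner l m y -> intertwiner l m (x + y).
Proof. by move=> hx hy; rewrite -[y]opprK intertwinerB ?intertwinerN. Qed.

Lemma intertwiner0 l m : intertwiner l m 0.
Proof. by apply/eqP; rewrite mulr0 mul0r. Qed.

Lemma intertwiner1 l : intertwiner l l 1.
Proof. by apply/eqP; rewrite mulr1 mul1r. Qed.

Lemma intertwinerV l m x : intertwiner l m x -> intertwiner m l x^-1.
Proof.
have [->|x0] := eqVneq x 0; first by rewrite invr0 !intertwiner0.
move=> /eqP e; apply/eqP; apply: (mulrI (x := x)) => //.
by rewrite !mulrA -e divrr // mul1r -mulrA divrr // mulr1.
Qed.

Lemma intertwinerVV l m x : l != 0 -> m != 0 ->
  intertwiner l m x -> intertwiner l^-1 m^-1 x.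
Proof.
move=> l0 m0 /eqP e; apply/eqP; apply: (mulrI (x := l)) => //.
by rewrite mulVKr // mulrA e mulrK.
Qed.

(** The norm is multiplicative. Hence diagonal entries of distinct moduli have no nonzero
    intertwiner. *)
Lemma intertwiner_norm l m x :
  intertwiner l m x -> x != 0 -> sqnormq l = sqnormq m.
Proof.
move=> /eqP e x0; have := congr1 sqnormq e; rewrite !sqnormqM [RHS]mulrC.
by apply: mulIf; rewrite sqnormq_eq0.
Qed.

(* With [L x = l x - x m] and [L' x = conj l x - x m], [L L'] is right
   multiplication by [u := q_l(m)], where [q_l] is the real quadratic killing
   [l]. If [u != 0] then [L] is onto; otherwise [L] satisfies
   [L^2 = (l - conj l) L], whence the quaternions are [ker L + im L]. *)
Lemma sylvester_split l m c :
  exists x, intertwiner l m (c + x * m - l * x).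
Proof.
pose L x := l * x - x * m; pose L' x := conjq l * x - x * m.
pose u : H := m * m - realq (qr l *+ 2) * m + realq (sqnormq l).
have LB x y : L (x - y) = L x - L y.
    rewrite /L mulrBr mulrBl !opprB addrACA [RHS]addrACA.
    by rewrite [- (l * y) - _]addrC.
have LL' x : L (L' x) = x * u.
  rewrite /L /L' /u /sqnormq; clear.
  case: l m x => [????] [????] [????].
  by congr Quat => /=; ring.
have Lu x y : y * m = m * y -> L (x * y) = L x * y.
  by move=> e; rewrite /L mulrBl !mulrA -!mulrA e.
have Lv y x : l * y = y * l -> L (y * x) = y * L x.
  by move=> e; rewrite /L mulrBr !mulrA e.
suff [x Lx] : exists x, L (c - L x) = 0.
  exists x; apply/eqP/subr0_eq; rewrite -[RHS]Lx /L.
  by rewrite opprB addrA.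
have [u0|u0] := eqVneq u 0; last first.
  (* As [u] is a real polynomial in [m], its inverse commutes with [m]; so [L] sends this witness to
     [c]. *)
  exists (L' c * u^-1); rewrite Lu.
    by rewrite LL' mulrK // subrr /L mulr0 mul0r subrr.
  apply/esym/commrV; rewrite /GRing.comm /u mulrDr mulrDl mulrBr mulrBl.
  by rewrite -!mulrA !realqC !mulrA.
pose v := l - conjq l.
have lv : l * v = v * l.
  by rewrite /v mulrBr mulrBl mulq_conj mulconjq.
have LLc : L (L c) = v * L c.
  apply: subr0_eq; rewrite -Lv // -LB.
  suff -> : L c - v * c = L' c by rewrite LL' u0 mulr0.
  by rewrite /L /L' /v mulrBl opprB [LHS]addrC addrA subrK.
(* If [v = 0] then [l] is real, so [u = (m - l)^2]; its vanishing gives [m = l] and [L = 0]. *)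
have [v0|v0] := eqVneq v 0.
  have el : l = realq (qr l).
    move/eqP: v0; rewrite /v subr_eq0; clear; case: l => a b c d /eqP [] *.
    by congr Quat; lra.
  have lC x : l * x = x * l by rewrite el realqC.
  have /eqP : (m - l) * (m - l) = 0.
    rewrite -u0 /u el /sqnormq; clear; case: m l => [????] [????].
    by congr Quat => /=; ring.
  rewrite mulq_eq0 orbb subr_eq0 => /eqP ml.
  by exists 0; rewrite /L ml !mulr0 !mul0r subrr subr0 lC subrr.
have vV : l * v^-1 = v^-1 * l by exact: commrV.
(* Since [L (L c) = v * L c], subtracting [L (v^-1 * c)] from [c] lands in the kernel of [L]. *)
by exists (v^-1 * c); rewrite Lv // LB Lv // LLc mulKr // subrr.
Qed.
End Quaternions.

(** * Normal forms of lower triangular 3 x 3 matrices *)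

Section LowerTriangular3.
Variable R : rcfType.
Local Notation H := (quat R).

Lemma detH_neq0 n (A B : 'M[H]_n) : A *m B = 1%:M -> detH A != 0.
Proof.
move=> e; have := detH1 R n; rewrite -e detHM => e1.
by apply: contra_eq_neq e1 => ->; rewrite mul0r eq_sym oner_neq0.
Qed.

Definition ltmx3 (d0 d1 d2 a b c : H) : 'M[H]_3 :=
  \matrix_(i, j)
    nth 0 (nth [::] [:: [:: d0; 0; 0]; [:: a; d1; 0]; [:: c; b; d2]] i) j.

Lemma ltmx3M d0 d1 d2 a b c e0 e1 e2 x y z :
  ltmx3 d0 d1 d2 a b c *m ltmx3 e0 e1 e2 x y z =
  ltmx3 (d0 * e0) (d1 * e1) (d2 * e2)
        (a * e0 + d1 * x) (b * e1 + d2 * y) (c * e0 + b * x + d2 * z).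
Proof.
apply/matrixP => -[[|[|[|//]]] ?] [[|[|[|//]]] ?];
  rewrite !mxE !big_ord_recl big_ord0 !mxE /=;
  by rewrite ?mulr0 ?mul0r ?addr0 ?add0r ?addrA.
Qed.

Lemma ltmx31 : 1%:M = ltmx3 1 1 1 0 0 0.
Proof. by apply/matrixP => -[[|[|[|//]]] ?] [[|[|[|//]]] ?]; rewrite !mxE. Qed.

Lemma trig_ltmx3 (T : 'M[H]_3) : is_trig_mx T ->
  T = ltmx3 (T 0 0) (T 1 1) (T 2%:R 2%:R) (T 1 0) (T 2%:R 1) (T 2%:R 0).
Proof.
move=> /is_trig_mxP tT; apply/matrixP => i j; rewrite !mxE.
case: i j => -[|[|[|//]]] ? [[|[|[|//]]] ?] /=;
  by [exact: tT | congr (T _ _); apply: val_inj].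
Qed.

Lemma ltmx3_unit d0 d1 d2 a b c : d0 != 0 -> d1 != 0 -> d2 != 0 ->
  detH (ltmx3 d0 d1 d2 a b c) != 0.
Proof.
move=> n0 n1 n2.
pose x := - (d1^-1 * (a * d0^-1)); pose y := - (d2^-1 * (b * d1^-1)).
apply: (@detH_neq0 _ _
  (ltmx3 d0^-1 d1^-1 d2^-1 x y (- (d2^-1 * (c * d0^-1 + b * x))))).
by rewrite ltmx3M ltmx31 /x /y !mulrN !mulVKr // !divrr // !subrr.
Qed.

(** The Sylvester equations on the subdiagonal are solved first; their solutions enter the constant
    term of the one at the corner. *)
Lemma ltmx3_split l0 l1 l2 a b c : exists U a' b' c',
  [/\ detH U != 0, U *m ltmx3 l0 l1 l2 a b c = ltmx3 l0 l1 l2 a' b' c' *m U,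
     intertwiner l1 l0 a', intertwiner l2 l1 b' & intertwiner l2 l0 c'].
Proof.
have [x hx] := sylvester_split l1 l0 a.
have [y hy] := sylvester_split l2 l1 b.
set a' := a + _ - _ in hx; set b' := b + _ - _ in hy.
have [z hz] := sylvester_split l2 l0 (c + y * a - b' * x).
set c' := _ + _ - _ in hz.
exists (ltmx3 1 1 1 x y z), a', b', c'.
split; [by rewrite ltmx3_unit ?oner_neq0| |exact: hx|exact: hy|exact: hz].
rewrite !ltmx3M !mul1r !mulr1 /a' /b' /c'; congr ltmx3.
- by rewrite subrK addrC.
- by rewrite subrK addrC.
- rewrite [RHS]addrAC subrK [RHS]addrAC subrK.
  by rewrite [LHS]addrC [_ + y * a]addrC addrA.
Qed.

(** A triangular matrix of intertwiners commutes with the diagonal part, so only the strictly lower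
    parts must be matched. A nonzero [a] or [b] absorbs the corner entry, which therefore matters
    only when both vanish. *)
Lemma ltmx3_similar l0 l1 l2 a b c a' b' c' :
  intertwiner l1 l0 a -> intertwiner l2 l1 b -> intertwiner l2 l0 c ->
  intertwiner l1 l0 a' -> intertwiner l2 l1 b' -> intertwiner l2 l0 c' ->
  (a == 0) = (a' == 0) -> (b == 0) = (b' == 0) ->
  (a = 0 -> b = 0 -> (c == 0) = (c' == 0)) ->
  exists2 Y, detH Y != 0 &
    Y *m ltmx3 l0 l1 l2 a b c = ltmx3 l0 l1 l2 a' b' c' *m Y.
Proof.
move=> ha hb hc ha' hb' hc' ea eb ec.
(* The last three equations are the nontrivial entries of [Y N = N' Y], with [N] and [N'] the
   strictly lower parts. *)
suff [y0 [y1 [y2 [x [y]]]]] : exists y0 y1 y2 x y,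
  [/\ [&& y0 != 0, y1 != 0 & y2 != 0],
     [/\ intertwiner l0 l0 y0, intertwiner l1 l1 y1 & intertwiner l2 l2 y2],
     intertwiner l1 l0 x, intertwiner l2 l1 y &
     [/\ y1 * a = a' * y0, y2 * b = b' * y1
       & y * a + y2 * c = c' * y0 + b' * x]].
  move=> [/and3P[n0 n1 n2]].
  move=> [/eqP h0 /eqP h1 /eqP h2] /eqP hx /eqP hy [e1 e2 e3].
  exists (ltmx3 y0 y1 y2 x y 0); first exact: ltmx3_unit.
  rewrite !ltmx3M h0 h1 h2 e1 e2 hx hy mul0r mulr0 add0r addr0 e3.
  by congr ltmx3; rewrite addrC.
have h1 l := intertwiner1 l; have h0 l m := intertwiner0 l m.
have n1 := oner_neq0 H.
have [a0|a0] := eqVneq a 0; have [b0|b0] := eqVneq b 0;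
  move: ea eb ec; rewrite ?a0 ?b0 ?(negPf a0) ?(negPf b0) ?eqxx.
- move=> /esym/eqP -> /esym/eqP -> /(_ erefl erefl).
  have [->|c0] := eqVneq c 0.
    move=> /esym/eqP ->; exists 1, 1, 1, 0, 0.
    by rewrite n1 !mul0r !mulr0 addr0.
  move=> /esym/negbT c'0; exists 1, 1, (c' * c^-1), 0, 0; split=> //.
  + by rewrite n1 mulq_eq0 negb_or c'0 -unitqE unitrV.
  + by split=> //; apply: intertwinerM hc' _; apply: intertwinerV.
  + by rewrite !mul0r !mulr0 mulrVK // mulr1 addr0 add0r.
- move=> /esym/eqP -> /esym/negbT b'0 _.
  have hy : intertwiner l2 l2 (b' * b^-1).
    by apply: intertwinerM hb' _; apply: intertwinerV.
  (* The equation at [b] dictates [y2]; the corner equation is then solved for [x], as [b'] is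
     invertible. *)
  exists 1, 1, (b' * b^-1), (b'^-1 * (b' * b^-1 * c - c')), 0; split=> //.
  + by rewrite n1 mulq_eq0 negb_or b'0 -unitqE unitrV.
  + apply: intertwinerM (intertwinerV hb') _.
    by apply: intertwinerB => //; apply: intertwinerM hy hc.
  + by rewrite mulrVK // mulVKr // !mul0r !mulr0 !mulr1 add0r addrC subrK.
- move=> /esym/negbT a'0 /esym/eqP -> _.
  exists 1, (a' * a^-1), 1, 0, ((c' - c) * a^-1); split=> //.
  + by rewrite n1 mulq_eq0 negb_or a'0 -unitqE unitrV andbT.
  + by split=> //; apply: intertwinerM ha' _; apply: intertwinerV.
  + by apply: intertwinerM _ (intertwinerV ha); apply: intertwinerB.
  + by rewrite !mulrVK // !mul0r !mulr0 !mulr1 mul1r addr0 subrK.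
move=> /esym/negbT a'0 /esym/negbT b'0 _.
have hy1 : intertwiner l1 l1 (a' * a^-1).
  by apply: intertwinerM ha' _; apply: intertwinerV.
have hy2 : intertwiner l2 l2 (b' * (a' * a^-1) * b^-1).
  by apply: intertwinerM _ (intertwinerV hb); apply: intertwinerM hb' hy1.
(* After [y0 = 1], the first two equations dictate [y1] and [y2], and the corner one is solved for
   [y]. *)
exists 1, (a' * a^-1), (b' * (a' * a^-1) * b^-1), 0,
  ((c' - b' * (a' * a^-1) * b^-1 * c) * a^-1); split=> //.
- by rewrite n1 !mulq_eq0 !negb_or a'0 b'0 -!unitqE !unitrV !unitqE a0 b0.
- apply: intertwinerM _ (intertwinerV ha); apply: intertwinerB => //.
  exact: intertwinerM hy2 hc.
- by rewrite mulr1 !mulrVK // mulr0 addr0 subrK mulr1.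
Qed.

End LowerTriangular3.

(* The terms of a permutation [s] vanish unless [r (s i) <= r i] for all [i],
   which forces [s = 1]. *)
Lemma det_ranked_trig (K : comNzRingType) n (A : 'M[K]_n) (r : 'I_n -> nat) :
  injective r -> (forall i j, (r i < r j)%N -> A i j = 0) ->
  \det A = \prod_i A i i.
Proof.
move=> r_inj tA; rewrite /determinant (bigD1 1%g) //= [X in _ + X]big1.
  rewrite addr0 odd_perm1 expr0 mul1r; apply: eq_bigr => i _.
  by rewrite perm1.
move=> s s1; have [i lt_i|le_s] := pickP (fun i => (r i < r (s i))%N).
  by rewrite (bigD1 i) //= tA // mul0r mulr0.
case/eqP: s1; apply/permP => i; rewrite perm1; apply: r_inj.
have le_r j : (r (s j) <= r j)%N by rewrite leqNgt le_s.
(* Reindexing by [s] shows that both sums of ranks agree, so every termwise inequality is an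
   equality. *)
have := @leqif_sum _ predT (fun j => r (s j) == r j) (fun j => r (s j)) r.
case=> [j _|_]; first exact: leqif_eq.
rewrite [X in _ == X](reindex_inj (@perm_inj _ s)) eqxx.
by move=> /esym/forallP/(_ i)/eqP.
Qed.

Lemma char_poly_mxE (K : nzRingType) n (A : 'M[K]_n) i j :
  char_poly_mx A i j = 'X *+ (i == j) - (A i j)%:P.
Proof. by rewrite !mxE. Qed.

(** * Triangularization over the quaternions and the determinant of [Phi] *)

Section Triangular.
Variable R : rcfType.
Local Notation H := (quat R).
Local Notation C := R[i].

Lemma Phi_ul n (A : 'M[H]_n) i j :
  Phi A (lshift n i) (lshift n j) = cpart1 (A i j).
Proof. by rewrite block_mxEul mxE. Qed.

Lemma Phi_ur n (A : 'M[H]_n) i j :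
  Phi A (lshift n i) (rshift n j) = cpart2 (A i j).
Proof. by rewrite block_mxEur mxE. Qed.

Lemma Phi_dl n (A : 'M[H]_n) i j :
  Phi A (rshift n i) (lshift n j) = - conjc (cpart2 (A i j)).
Proof. by rewrite block_mxEdl !mxE. Qed.

Lemma Phi_dr n (A : 'M[H]_n) i j :
  Phi A (rshift n i) (rshift n j) = conjc (cpart1 (A i j)).
Proof. by rewrite block_mxEdr !mxE. Qed.

(* Reorders the rows and columns of [Phi A] into 2 x 2 blocks, one per entry. *)
Definition interleave n (k : 'I_(n + n)) : nat :=
  match split k with inl i => i.*2 | inr i => i.*2.+1 end.

Lemma interleave_l n (i : 'I_n) : interleave (lshift n i) = i.*2.
Proof. by rewrite /interleave (unsplitK (inl i)). Qed.

Lemma interleave_r n (i : 'I_n) : interleave (rshift n i) = i.*2.+1.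
Proof. by rewrite /interleave (unsplitK (inr i)). Qed.

Lemma interleave_inj n : injective (@interleave n).
Proof.
move=> i j; rewrite -(splitK i) -(splitK j).
case: (split i) (split j) => [k|k] [l|l] /=;
  rewrite ?interleave_l ?interleave_r.
- by move=> /double_inj/val_inj ->.
- by move=> /(congr1 odd); rewrite /= !odd_double.
- by move=> /(congr1 odd); rewrite /= !odd_double.
by move=> [] /double_inj/val_inj ->.
Qed.

(** A complex diagonal entry gives a diagonal 2 x 2 block made of it and its conjugate, so the
    interleaved matrix is triangular entry by entry, not just blockwise. *)
Lemma Phi_interleave_trig n (T : 'M[H]_n) :
  is_trig_mx T -> (forall i, cpart2 (T i i) = 0) ->
  forall i j, (interleave i < interleave j)%N -> Phi T i j = 0.
Proof.
move=> /is_trig_mxP tT cT i j; rewrite -(splitK i) -(splitK j).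
case: (split i) (split j) => [k|k] [l|l] /=;
  rewrite ?interleave_l ?interleave_r ?ltn_double ?ltnS ?leq_double.
- by move=> lt_kl; rewrite Phi_ul tT.
- rewrite Phi_ur leq_eqVlt => /orP[/eqP/val_inj ->|/tT ->] //.
- by rewrite -doubleS leq_double => lt_kl; rewrite Phi_dl tT // raddf0 oppr0.
by rewrite ltn_double => lt_kl; rewrite Phi_dr tT // raddf0.
Qed.

Lemma char_poly_Phi_trig n (T : 'M[H]_n) :
  is_trig_mx T -> (forall i, cpart2 (T i i) = 0) ->
  char_poly (Phi T) = \prod_i (('X - (cpart1 (T i i))%:P)
                              * ('X - (conjc (cpart1 (T i i)))%:P)).
Proof.
move=> tT cT; rewrite /char_poly (det_ranked_trig (@interleave_inj n)).
  rewrite big_split_ord /= -big_split; apply: eq_bigr => i _ /=.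
  by rewrite !char_poly_mxE Phi_ul Phi_dr !eqxx.
move=> i j lt_ij; rewrite char_poly_mxE Phi_interleave_trig //.
have /negPf -> : i != j by apply: contraTneq lt_ij => ->; rewrite ltnn.
by rewrite mulr0n subr0.
Qed.

Lemma detH_trig n (T : 'M[H]_n) :
  is_trig_mx T -> (forall i, cpart2 (T i i) = 0) ->
  detH T = (\prod_i sqnormq (T i i))%:C%C.
Proof.
move=> tT cT; rewrite /detH (det_ranked_trig (@interleave_inj n)); last first.
  exact: Phi_interleave_trig.
rewrite big_split_ord /= -big_split rmorph_prod; apply: eq_bigr => i _ /=.
rewrite Phi_ul Phi_dr; case: (T i i) (cT i) => a b c d [-> ->].
by rewrite /sqnormq /=; congr Complex => /=; ring.
Qed.

(** If the first entry is nonzero, an upper triangular block matrix works; a column swap reduces to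
    that case. *)
Lemma row_extend n (q : 'rV[H]_n.+1) : q != 0 ->
  exists2 S : 'M_n.+1, detH S != 0 & row 0 S = q.
Proof.
have base (p : 'rV[H]_(1 + n)) : p 0 0 != 0 ->
    exists2 S : 'M_(1 + n), exists S', S *m S' = 1%:M & row 0 S = p.
  move=> p0; pose a := p 0 0; pose w := rsubmx p.
  have ep : p = row_mx a%:M w.
    rewrite -[LHS]hsubmxK; congr row_mx; apply/rowP => j.
    by rewrite ord1 !mxE; congr (p _ _); apply: val_inj.
  exists (block_mx a%:M w 0 1%:M).
    exists (block_mx a^-1%:M (- (a^-1 *: w)) 0 1%:M).
    rewrite mulmx_block !mul0mx !mulmx0 !mul1mx !mulmx1 !addr0 !add0r.
    rewrite mul_scalar_mx mulmxN mul_scalar_mx scalerA divrr // scale1r addNr.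
    by rewrite scale_scalar_mx divrr // -scalar_mx_block.
  rewrite [RHS]ep; apply/rowP => j; rewrite mxE.
  rewrite -[RHS](col_mxEu _ (row_mx 0 1%:M)).
  by congr (block_mx _ _ _ _ _ _); apply: val_inj.
case/rV0Pn => k qk.
pose P : 'M[H]_n.+1 := tperm_mx 0 k.
have PP : P *m P = 1%:M by rewrite -perm_mxM tperm2 perm_mx1.
have [|S [S' SS'] rS] := base (q *m P); first by rewrite -xcolE mxE tpermL.
exists (S *m P).
  apply: (@detH_neq0 _ _ _ (P *m S')).
  by rewrite mulmxA -[S *m P *m P]mulmxA PP mulmx1.
by rewrite row_mul rS -mulmxA PP mulmx1.
Qed.

Lemma quat_eq (x y : H) : cpart1 x = cpart1 y -> cpart2 x = cpart2 y -> x = y.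
Proof. by move=> e1 e2; rewrite [x]cpartE [y]cpartE e1 e2. Qed.

(* A row eigenvector [(v1, v2)] of [Phi A] is the row [v1 + v2 j]. *)
Lemma left_eigenrow n (A : 'M[H]_n.+1) :
  exists l (q : 'rV[H]_n.+1), [/\ q != 0, cpart2 l = 0 & q *m A = l *: q].
Proof.
have /closed_rootP[a] : size (char_poly (Phi A)) != 1 by rewrite size_char_poly.
rewrite -eigenvalue_root_char => /eigenvalueP[v].
rewrite -[v]hsubmxK; move: (lsubmx v) (rsubmx v) => v1 v2.
rewrite /Phi mul_row_block scale_row_mx => /eq_row_mx[/rowP e1 /rowP e2] v0.
exists (quat_of_complex a), (\row_j quat_of_pair (v1 0 j) (v2 0 j)); split.
- apply: contraNneq v0 => /rowP e.
  have [-> ->] : v1 = 0 /\ v2 = 0; last by rewrite row_mx0.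
  split; apply/rowP => j; move: (e j); rewrite !mxE.
    by move/(congr1 (@cpart1 R)); rewrite quat_of_pairK1.
  by move/(congr1 (@cpart2 R)); rewrite quat_of_pairK2.
- by [].
have cl : cpart1 (quat_of_complex a) = a by case: (a).
apply/rowP => j; apply: quat_eq; rewrite !mxE raddf_sum.
  move: (e1 j); rewrite mulmxN cpart1M cl [cpart2 (quat_of_complex a)]/=.
  rewrite mul0r subr0 quat_of_pairK1 !mxE => <-.
  rewrite -sumrB; apply: eq_bigr => k _ /=.
  by rewrite cpart1M !mxE quat_of_pairK1 quat_of_pairK2.
move: (e2 j); rewrite /= cpart2M cl [cpart2 (quat_of_complex a)]/= mul0r addr0.
rewrite quat_of_pairK2 !mxE => <-; rewrite -big_split; apply: eq_bigr => k _ /=.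
by rewrite cpart2M !mxE quat_of_pairK1 quat_of_pairK2.
Qed.

Lemma detH_inverse n (A : 'M[H]_n) : detH A != 0 ->
  exists2 B, A *m B = 1%:M & B *m A = 1%:M.
Proof.
move=> A0; have uA : Phi A \in unitmx by rewrite unitmxE unitfE.
exists (Phi_inv (invmx (Phi A))); apply: Phi_inj.
  by rewrite PhiM Phi1 Phi_inv_unit // mulmxV.
by rewrite PhiM Phi1 Phi_inv_unit // mulVmx.
Qed.

(** Deflation: a basis change whose first row is a left eigenrow makes the first row of the
    conjugate [(l, 0)] with [l] complex, and induction treats the lower right block. *)
Lemma trigonalize n (A : 'M[H]_n) : exists S T : 'M[H]_n,
  [/\ detH S != 0, S *m A = T *m S, is_trig_mx T
    & forall i, cpart2 (T i i) = 0].
Proof.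
elim: n A => [|n IHn] A.
  exists 1%:M, A; rewrite mul1mx mulmx1 detH1 oner_neq0; split=> //.
    by apply/is_trig_mxP => -[].
  by case.
have [l [q [q0 cl qA]]] := left_eigenrow A.
have [S S0 rS] := row_extend q0.
have [S' SS' S'S] := detH_inverse S0.
pose B : 'M[H]_(1 + n) := S *m A *m S'.
have rB : row 0 B = l *: row 0 1%:M.
  by rewrite /B !row_mul rS qA -rS -scalemxAl -row_mul SS'.
have ulB : ulsubmx B = l%:M.
  apply/matrixP => i j; move/rowP/(_ (lshift n j)): rB; rewrite !ord1 !mxE.
  by rewrite !lshift0 => ->; rewrite mulr1.
have urB : ursubmx B = 0.
  apply/matrixP => i j; move/rowP/(_ (rshift 1 j)): rB; rewrite !ord1 !mxE.
  by rewrite lshift0 => ->; rewrite mulr0.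
have [T' [U [T'0 eT tU cU]]] := IHn (drsubmx B).
pose T : 'M[H]_(1 + n) := block_mx l%:M 0 (T' *m dlsubmx B) U.
pose Q : 'M[H]_(1 + n) := block_mx 1%:M 0 0 T'.
have QB : Q *m B = T *m Q.
  rewrite -[B]submxK ulB urB /Q /T !mulmx_block.
  by rewrite !mul0mx !mulmx0 !mul1mx !mulmx1 !addr0 !add0r eT.
have Q0 : detH Q != 0.
  have [V TV _] := detH_inverse T'0.
  apply: (@detH_neq0 _ _ _ (block_mx 1%:M 0 0 V)).
  rewrite mulmx_block !mul0mx !mulmx0 !mul1mx !addr0 !add0r TV.
  by rewrite -scalar_mx_block.
exists (Q *m S), T; split.
- by rewrite detHM mulf_neq0.
- rewrite mulmxA -QB /B -(mulmxA Q (S *m A *m S') S).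
  by rewrite -(mulmxA (S *m A)) S'S mulmx1 mulmxA.
- by change (is_trig_mx T); rewrite is_trig_block_mx // mx11_is_trig tU eqxx.
rewrite -[n.+1]/(1 + n)%N => i.
rewrite -(splitK i); case: (split i) => k /=.
  by rewrite block_mxEul mxE eqxx.
by rewrite block_mxEdr.
Qed.

(** A triangular conjugate has as its [detH] the product of the square norms on its diagonal. *)
Lemma detH_ge0 n (A : 'M[H]_n) : exists2 r : R, 0 <= r & detH A = r%:C%C.
Proof.
have [S [T [S0 e tT cT]]] := trigonalize A.
exists (\prod_i sqnormq (T i i)).
  by apply: prodr_ge0 => i _; rewrite /sqnormq !addr_ge0 ?sqr_ge0.
rewrite -detH_trig //; apply: (mulfI S0).
by rewrite -detHM e detHM mulrC.
Qed.

End Triangular.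

(** * Characteristic polynomials under conjugation and inversion *)

Lemma char_poly_intertwined (K : idomainType) n (P A B : 'M[K]_n) :
  \det P != 0 -> P *m A = B *m P -> char_poly A = char_poly B.
Proof.
move=> P0 e; have : map_mx polyC P *m char_poly_mx A
    = char_poly_mx B *m map_mx polyC P.
  rewrite /char_poly_mx mulmxBr mulmxBl -!map_mxM e; congr (_ - _).
  by rewrite scalar_mxC.
move/(congr1 determinant); rewrite !det_mulmx mulrC; apply: mulIf.
by rewrite det_map_mx polyC_eq0.
Qed.

Lemma horner_char_poly (K : comNzRingType) n (A : 'M[K]_n) t :
  (char_poly A).[t] = \det (t%:M - A).
Proof.
rewrite -[LHS]/(horner_eval t _) -det_map_mx; congr (\det _).
apply/matrixP => i j; rewrite !mxE /= /horner_eval.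
by rewrite hornerD hornerN hornerC hornerMn hornerX.
Qed.

Lemma char_poly_reverse (K : fieldType) n (P A : 'M[K]_n) t :
  \det P != 0 -> \det A = 1 -> A *m P *m A = P -> t != 0 ->
  (char_poly A).[t] = (- t) ^+ n * (char_poly A).[t^-1].
Proof.
move=> P0 A1 e t0; rewrite !horner_char_poly.
have /(congr1 determinant) :
    (t%:M - A) *m (P *m A) = P *m ((- t) *: (t^-1%:M - A)).
  rewrite mulmxBl (mulmxA A) e mul_scalar_mx -scalemxAr mulmxBr mul_mx_scalar.
  by rewrite scalerBr scalerA mulNr divff // !scaleNr scale1r opprK addrC.
rewrite !det_mulmx A1 mulr1 detZ mulrC; exact: mulfI.
Qed.

(** * Construction of reversing matrices *)

Section Reversers.
Variable R : rcfType.
Local Notation H := (quat R).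
Local Notation C := R[i].

(* A monomial matrix supported on the graph of [f]. *)
Lemma diag_reversible n (d : 'I_n -> H) (f : 'I_n -> 'I_n) (w : 'I_n -> H) :
  injective f -> (forall i, w i != 0) ->
  (forall i, d i * w i * d (f i) = w i) ->
  exists2 X : 'M[H]_n, detH X != 0 &
    diag_mx (\row_i d i) *m X *m diag_mx (\row_i d i) = X.
Proof.
move=> f_inj w0 dw; exists (\matrix_(i, j) (if j == f i then w i else 0)).
  apply: (@detH_neq0 _ _ _ (\matrix_(i, j) (if i == f j then (w j)^-1 else 0))).
  apply/matrixP => i j; rewrite !mxE (bigD1 (f i)) //= big1 ?addr0.
    rewrite !mxE eqxx (inj_eq f_inj).
    case: eqP => [->|_]; last by rewrite mulr0.
    by rewrite divrr // unitqE.
  by move=> k /negPf ki; rewrite !mxE ki mul0r.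
rewrite mul_diag_mx mul_mx_diag; apply/matrixP => i j; rewrite !mxE.
by case: eqP => [->|_]; rewrite ?dw // mulr0 mul0r.
Qed.

Lemma invq_unit (l : H) : sqnormq l = 1 -> l^-1 = conjq l.
Proof.
move=> nl; have l0 : l != 0 by rewrite -sqnormq_eq0 nl oner_neq0.
by apply: (mulrI (x := l)) => //; rewrite divrr // mulq_conj nl.
Qed.

Lemma jq_neq0 : jq R != 0.
Proof.
rewrite -sqnormq_eq0 /sqnormq /= expr1n !expr0n /= !add0r addr0.
exact: oner_neq0.
Qed.

(** Conjugation by [j] is complex conjugation on complex numbers, which inverts those of modulus
    1. *)
Lemma intertwiner_j (l : H) :
  sqnormq l = 1 -> cpart2 l = 0 -> intertwiner l l^-1 (jq R).
Proof.
move=> nl; rewrite invq_unit // /intertwiner; case: l {nl} => a b c d [-> ->].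
by apply/eqP; congr Quat => /=; ring.
Qed.

(* The matrix [ltmx3 l0 l1 l2 a' b' c'] of the proof is [(j T j^-1)^-1]; if [Y]
   conjugates [T] to it, then [X := j^-1 Y] satisfies [T X T = X]. *)
Lemma ltmx3_reversible (l0 l1 l2 a b c : H) :
  sqnormq l0 = 1 -> sqnormq l1 = 1 -> sqnormq l2 = 1 ->
  cpart2 l0 = 0 -> cpart2 l1 = 0 -> cpart2 l2 = 0 ->
  intertwiner l1 l0 a -> intertwiner l2 l1 b -> intertwiner l2 l0 c ->
  exists2 X, detH X != 0 &
    ltmx3 l0 l1 l2 a b c *m X *m ltmx3 l0 l1 l2 a b c = X.
Proof.
move=> u0 u1 u2 k0 k1 k2 ha hb hc.
have nz (l : H) : sqnormq l = 1 -> l != 0.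
  by rewrite -sqnormq_eq0 => ->; exact: oner_neq0.
have [n0 n1 n2] : [/\ l0 != 0, l1 != 0 & l2 != 0] by split; exact: nz.
have j0 := jq_neq0; set j := jq R in j0.
have jj : j * j = -1 by rewrite -expr2; have [_ ->] := hamilton R.
have jV : j^-1 = - j.
  by apply: (mulrI (x := j)) => //; rewrite divrr // mulrN jj opprK.
have hj l : sqnormq l = 1 -> cpart2 l = 0 ->
    intertwiner l l^-1 (l * j) /\ intertwiner l^-1 l (j * l).
  move=> ul kl; have hl := intertwiner_j ul kl.
  split; first by apply: intertwinerM hl; exact: eqxx.
  apply: intertwinerM (_ : intertwiner l l l); last exact: eqxx.
  by rewrite -[j]opprK -jV intertwinerN ?intertwinerV.
have [hl0 hr0] := hj _ u0 k0; have [hl1 hr1] := hj _ u1 k1.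
have [hl2 hr2] := hj _ u2 k2.
have ljl l : sqnormq l = 1 -> cpart2 l = 0 -> l * j * l = j.
  move=> ul kl; have /eqP -> := intertwiner_j ul kl.
  by rewrite mulrVK // unitqE nz.
(* With [T'] the primed matrix, these entries solve [T j^-1 T' = j^-1]; signs cancel because
   [l j l = j] makes [- l j] the inverse of [l j]. *)
pose a' := l1 * j * a * (j * l0); pose b' := l2 * j * b * (j * l1).
pose c' := l2 * j * (c * (j * l0) + b * (j * a')).
(* The left factor passes from [l1] to [l1^-1], [a] from there to [l0^-1], and the right factor back
   to [l0]. *)
have ha' : intertwiner l1 l0 a'.
  exact: intertwinerM (intertwinerM hl1 (intertwinerVV n1 n0 ha)) hr0.
have hb' : intertwiner l2 l1 b'.
  exact: intertwinerM (intertwinerM hl2 (intertwinerVV n2 n1 hb)) hr1.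
have hc' : intertwiner l2 l0 c'.
  apply: intertwinerM hl2 (intertwinerD _ _).
    exact: intertwinerM (intertwinerVV n2 n0 hc) hr0.
  apply: intertwinerM (intertwinerVV n2 n1 hb) (intertwinerM _ ha').
  by rewrite -[j]opprK -jV intertwinerN ?intertwinerV ?intertwiner_j.
have [|||Y Y0 eY] := ltmx3_similar ha hb hc ha' hb' hc'.
- by rewrite !mulq_eq0 (negPf n1) (negPf n0) (negPf j0) !orbF.
- by rewrite !mulq_eq0 (negPf n2) (negPf n1) (negPf j0) !orbF.
- move=> _ eb.
  rewrite /c' eb mul0r addr0 !mulq_eq0.
  by rewrite (negPf n2) (negPf n0) (negPf j0) !orbF.
pose K : 'M[H]_3 := ltmx3 (- j) (- j) (- j) 0 0 0.
exists (K *m Y).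
  by rewrite detHM mulf_neq0 // ltmx3_unit ?oppr_eq0.
rewrite -!mulmxA eY !mulmxA; congr (_ *m Y).
rewrite !ltmx3M; congr ltmx3.
- by rewrite mulrN mulNr ljl.
- by rewrite mulrN mulNr ljl.
- by rewrite mulrN mulNr ljl.
- rewrite mulr0 addr0 /a' mulrN mulNr mulrN mulNr !mulrA ljl // jj.
  by rewrite mulN1r !mulNr opprK addNr.
- rewrite mulr0 addr0 /b' mulrN mulNr mulrN mulNr !mulrA ljl // jj.
  by rewrite mulN1r !mulNr opprK addNr.
- clearbody a'; rewrite !mulr0 !addr0 mulrN mulNr [l2 * - j]mulrN
    mulNr /c' !mulrA ljl // jj.
  by rewrite mulN1r opprK mulrN mulNr addrACA !addNr addr0.
Qed.

Lemma ord3P (i : 'I_3) : [\/ i = 0, i = 1 | i = 2%:R].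
Proof.
case: i => [[|[|[|//]]] ?];
  by [constructor 1; exact: val_inj | constructor 2; exact: val_inj
     | constructor 3; exact: val_inj].
Qed.

Lemma prod_ord3 (K : comPzRingType) (F : 'I_3 -> K) :
  \prod_i F i = F 0 * (F 1 * F 2%:R).
Proof.
rewrite !big_ord_recl big_ord0 mulr1; congr (F _ * (F _ * F _)); exact: val_inj.
Qed.

(** Let two values equal [a] and the third be [c]. The inverse of [a] is [a] or [c]: the first
    forces [a = 1] by positivity, the second turns the product into [a]. Either way all are 1. *)
Lemma inverse_closed_dichotomy (n : 'I_3 -> R) :
  (forall i, 0 < n i) -> \prod_i n i = 1 ->
  (forall i, exists j, n i * n j = 1) ->
  (forall i, n i = 1) \/ injective n.
Proof.
rewrite prod_ord3 => n0 n1 nV.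
have key (a b c : R) : 0 < a -> a = b -> a * (b * c) = 1 ->
    a * a = 1 \/ a * b = 1 \/ a * c = 1 -> [/\ a = 1, b = 1 & c = 1].
  move=> a0 <- abc h.
  have a1 : a = 1.
    case: h => [h|[h|h]]; last by rewrite -abc h mulr1.
      by apply/eqP; rewrite -sqrp_eq1 ?ltW // expr2 h.
    by apply/eqP; rewrite -sqrp_eq1 ?ltW // expr2 h.
  by move: abc; rewrite a1 !mul1r => ->.
have {}nV i : n i * n 0 = 1 \/ n i * n 1 = 1 \/ n i * n 2%:R = 1.
  by have [j] := nV i; case: (ord3P j) => ->; tauto.
have all1 : n 0 = 1 -> n 1 = 1 -> n 2%:R = 1 -> forall i, n i = 1.
  by move=> ? ? ? i; case: (ord3P i) => ->.
have [e|d01] := eqVneq (n 0) (n 1).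
  left; have [] := key _ _ _ (n0 0) e n1 (nV 0); exact: all1.
have [e|d02] := eqVneq (n 0) (n 2%:R).
  have n1' : n 0 * (n 2%:R * n 1) = 1 by rewrite [n 2%:R * _]mulrC.
  left; have [|? ? ?] := key _ _ _ (n0 0) e n1'; last exact: all1.
  by have := nV 0; tauto.
have [e|d12] := eqVneq (n 1) (n 2%:R).
  have n1' : n 1 * (n 2%:R * n 0) = 1 by rewrite mulrA mulrC.
  left; have [|? ? ?] := key _ _ _ (n0 1) e n1'; last exact: all1.
  by have := nV 1; tauto.
right=> i j; case: (ord3P i) => ->; case: (ord3P j) => -> // /eqP;
  by rewrite ?(negPf d01) ?(negPf d02) ?(negPf d12) // eq_sym
    ?(negPf d01) ?(negPf d02) ?(negPf d12).
Qed.

Lemma cpart1_jM (x : H) : cpart1 (jq R * x) = - conjc (cpart2 x).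
Proof. by case: x => a b c d; congr Complex => /=; ring. Qed.

Lemma cpart2_jM (x : H) : cpart2 (jq R * x) = conjc (cpart1 x).
Proof. by case: x => a b c d; congr Complex => /=; ring. Qed.

Lemma trig_reversible (T : 'M[H]_3) :
  is_trig_mx T -> (forall i, cpart2 (T i i) = 0) -> detH T = 1 ->
  (forall i, exists j, cpart1 (T i i) * cpart1 (T j j) = 1
                    \/ cpart1 (T i i) * conjc (cpart1 (T j j)) = 1) ->
  exists S T' X, [/\ detH S != 0, S *m T = T' *m S, detH X != 0
                  & T' *m X *m T' = X].
Proof.
move=> tT cT dT lT.
(* The witness is 1 when the complex diagonal entries are inverse to each other, and the quaternion
   [j] when one must first be conjugated. *)
have rev i : exists j, exists2 w, w != 0 & T i i * w * T j j = w.
  have [j [e|e]] := lT i; exists j.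
    exists 1; rewrite ?oner_neq0 // mulr1; apply: quat_eq.
      by rewrite cpart1M e (cT i) mul0r subr0.
    by rewrite cpart2M (cT i) (cT j) mulr0 mul0r addr0.
  exists (jq R); rewrite ?jq_neq0 // -mulrA; apply: quat_eq.
    by rewrite cpart1M cpart1_jM (cT i) (cT j) conjc0 oppr0 mulr0 mul0r subr0.
  by rewrite cpart2M cpart2_jM e (cT i) mul0r addr0.
have nM i j w : w != 0 -> T i i * w * T j j = w ->
    sqnormq (T i i) * sqnormq (T j j) = 1.
  move=> w0 /(congr1 (@sqnormq R)); rewrite !sqnormqM mulrAC => e.
  by apply: (@mulIf _ (sqnormq w)); rewrite ?sqnormq_eq0 // e mul1r.
have n0 i : 0 < sqnormq (T i i).
  have [j [w w0 e]] := rev i; rewrite lt_def sqnormq_eq0.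
  rewrite /sqnormq !addr_ge0 ?sqr_ge0 // andbT.
  by apply: contra_neq w0 => z; rewrite -e z !mul0r.
have n1 : \prod_i sqnormq (T i i) = 1.
  by move: dT; rewrite detH_trig // => -[].
have nV i : exists j, sqnormq (T i i) * sqnormq (T j j) = 1.
  by have [j [w w0 e]] := rev i; exists j; exact: nM e.
have [U [a [b [c [U0 eU ha hb hc]]]]] :=
  ltmx3_split (T 0 0) (T 1 1) (T 2%:R 2%:R)
  (T 1 0) (T 2%:R 1) (T 2%:R 0).
rewrite -trig_ltmx3 // in eU.
exists U, (ltmx3 (T 0 0) (T 1 1) (T 2%:R 2%:R) a b c).
have [u|inj] := inverse_closed_dichotomy n0 n1 nV.
  have [X X0 eX] := ltmx3_reversible (u 0) (u 1) (u 2%:R)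
                      (cT 0) (cT 1) (cT 2%:R) ha hb hc.
  by exists X.
(* Distinct moduli kill the off-diagonal entries, leaving a diagonal matrix. *)
have z i j x : i != j -> intertwiner (T i i) (T j j) x -> x = 0.
  move=> ij hx; apply: contraNeq ij => x0; apply/eqP/inj.
  exact: intertwiner_norm hx x0.
have [f /fin_all_exists2[w w0 fw]] := fin_all_exists rev.
(* The norm at [f i] is inverse to the norm at [i], and the norms are pairwise distinct. *)
have f_inj : injective f.
  move=> i k e; apply: inj; apply: (@mulIf _ (sqnormq (T (f i) (f i)))).
    by rewrite gt_eqF.
  by rewrite (nM _ _ _ (w0 i) (fw i)) e (nM _ _ _ (w0 k) (fw k)).
have [X X0 eX] := diag_reversible f_inj w0 fw.
exists X; split; [exact: U0|exact: eU|exact: X0|].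
suff -> : ltmx3 (T 0 0) (T 1 1) (T 2%:R 2%:R) a b c =
  diag_mx (\row_i T i i) by exact: eX.
rewrite (z _ _ _ _ ha) // (z _ _ _ _ hb) // (z _ _ _ _ hc) //.
apply/matrixP => -[[|[|[|//]]] ?] [[|[|[|//]]] ?]; rewrite !mxE //=;
  by rewrite mulr1n; congr (T _ _); apply: val_inj.
Qed.

(** Intermediate values between 0 and [1 + x], as [(1 + x)^(n+1) >= 1 + x >= x]. *)
Lemma pos_root (x : R) n : 0 <= x -> exists2 s, 0 <= s & s ^+ n.+1 = x.
Proof.
move=> x0; have p0 : 0 <= 1 + x by rewrite addr_ge0.
have [|s /andP[s0 _]] := @poly_ivt _ ('X^(n.+1) - x%:P) _ _ p0.
  rewrite !hornerE expr0n /= sub0r oppr_le0 x0 subr_ge0.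
  apply: le_trans (_ : 1 + x <= _); first by rewrite lerDr.
  by rewrite exprS ler_peMr // exprn_ege1 // lerDl.
by rewrite rootE !hornerE subr_eq0 => /eqP; exists s.
Qed.

Lemma detH_scalar n (s : R) :
  detH ((realq s)%:M : 'M[H]_n) = ((s ^+ 2) ^+ n)%:C%C.
Proof.
rewrite detH_trig ?scalar_mx_is_trig //; last by move=> i; rewrite mxE eqxx.
congr (_%:C)%C; rewrite -[n in RHS]card_ord -prodr_const; apply: eq_bigr => i _.
by rewrite mxE eqxx /sqnormq /= expr0n /= !addr0.
Qed.

(** The form without inverses is preserved by [Phi] and by real scaling of [h]. *)
Lemma reversibleP n (g : SL R n) :
  reversible g <-> exists h : SL R n, g *m h *m g = h.
Proof.
split=> -[h].
  move=> /(congr1 (fun x => h * x * g)%g); rewrite conjgE !mulgA mulgV mul1g.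
  by rewrite mulgKV => /(congr1 val) e; exists h.
move=> e; exists h; have {}e : (g * h * g = h)%g by apply: val_inj.
by apply: (mulIg g); rewrite conjgE mulVg -mulgA e mulVg.
Qed.

Lemma SL_reverser_of_invertible n (g : SL R n.+1) P :
  detH P != 0 -> g *m P *m g = P -> exists h : SL R n.+1, g *m h *m g = h.
Proof.
have [r r0 eP] := detH_ge0 P; rewrite eP => rn0 e.
have rp : 0 < r by rewrite lt_def r0 andbT; apply: contra_neq rn0 => ->.
have rV0 : 0 <= r^-1 by rewrite invr_ge0.
have [t t0 et] := pos_root n rV0.
(* A real scalar [s] has [detH] equal to [s^(2(n+1))], hence the square root of an [(n+1)]-st root
   of [r^-1]. *)
pose c : H := realq (Num.sqrt t).
have cC : g *m c%:M = c%:M *m g.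
  rewrite mul_scalar_mx -diag_const_mx mul_mx_diag; apply/matrixP => i j.
  by rewrite !mxE realqC.
have hP : SL_pred (c%:M *m P).
  rewrite /SL_pred detHM detH_scalar sqr_sqrtr // et eP -rmorphM.
  by rewrite mulVf ?lt0r_neq0.
by exists (MkSL hP); rewrite /= mulmxA cC -!mulmxA (mulmxA (val g)) e.
Qed.

(** Pulling [X] back along the conjugation gives [P^-1 X P], which is then rescaled. *)
Lemma SL_reverser_conj n (g : SL R n.+1) P T X :
  detH P != 0 -> P *m g = T *m P -> detH X != 0 -> T *m X *m T = X ->
  exists h : SL R n.+1, g *m h *m g = h.
Proof.
move=> P0 e X0 eX; have [V PV VP] := detH_inverse P0.
have V0 := detH_neq0 VP.
have gV : val g *m V = V *m T.
  by rewrite -[LHS]mul1mx -VP -mulmxA (mulmxA P) e -mulmxA PV mulmx1.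
apply: (@SL_reverser_of_invertible _ g (V *m X *m P)).
  by rewrite !detHM; apply: mulf_neq0; first exact: mulf_neq0.
rewrite !mulmxA gV -[LHS]mulmxA e mulmxA; congr (_ *m P).
by rewrite -!mulmxA (mulmxA T) eX.
Qed.

End Reversers.

(** * Palindromic sextics and the reversibility criterion *)

Section CharPoly.
Variable R : rcfType.
Local Notation H := (quat R).
Local Notation C := R[i].

Definition sextic (c1 c2 c3 c4 c5 : R) : {poly R} :=
  'X^6 - c5 *: 'X^5 + c4 *: 'X^4 - c3 *: 'X^3 + c2 *: 'X^2 - c1 *: 'X + 1.

Lemma real_quadratic (q : H) : cpart2 q = 0 ->
  ('X - (cpart1 q)%:P) * ('X - (conjc (cpart1 q))%:P) =
  map_poly (real_complex R) ('X^2 - (qr q *+ 2) *: 'X + (sqnormq q)%:P).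
Proof.
case: q => a b c d [-> ->]; rewrite /sqnormq /=.
rewrite rmorphD rmorphB /= map_polyXn map_polyZ map_polyX map_polyC /=.
have -> : (a *+ 2)%:C%C = Complex a b + conjc (Complex a b).
  by congr Complex => /=; ring.
have -> : (a ^+ 2 + b ^+ 2 + 0 ^+ 2 + 0 ^+ 2)%:C%C
    = Complex a b * conjc (Complex a b).
  by congr Complex => /=; ring.
by rewrite -mul_polyC polyCD polyCM; ring.
Qed.

Lemma sextic_of_quadratics (t0 t1 t2 s0 s1 s2 : R) : s0 * (s1 * s2) = 1 ->
  exists c1 c2 c3 c4 c5,
    ('X^2 - t0 *: 'X + s0%:P) *
      (('X^2 - t1 *: 'X + s1%:P) * ('X^2 - t2 *: 'X + s2%:P)) =
    sextic c1 c2 c3 c4 c5.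
Proof.
move=> s1E.
exists (t0 * s1 * s2 + t1 * s0 * s2 + t2 * s0 * s1).
exists (s0 * s1 + s0 * s2 + s1 * s2
  + s0 * t1 * t2 + s1 * t0 * t2 + s2 * t0 * t1).
exists (t0 * t1 * t2 + s0 * (t1 + t2) + s1 * (t0 + t2) + s2 * (t0 + t1)).
exists (t0 * t1 + t0 * t2 + t1 * t2 + s0 + s1 + s2), (t0 + t1 + t2).
rewrite /sextic -[1 in RHS]/(1%:P) -s1E -!mul_polyC !(polyCD, polyCM).
by ring.
Qed.

Lemma sextic_reverse_coef c1 c2 c3 c4 c5 :
  (forall x, x != 0 -> (sextic c1 c2 c3 c4 c5).[x] =
     x ^+ 6 * (sextic c1 c2 c3 c4 c5).[x^-1]) ->
  c5 = c1 /\ c4 = c2.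
Proof.
move=> h.
(* This is the difference of the two sides, in which [c3] cancels. *)
have {}h x : x != 0 ->
    (c1 - c5) * (x ^+ 4 - 1) * x + (c4 - c2) * (x ^+ 2 - 1) * x ^+ 2 = 0.
  move=> x0; have := h _ x0; rewrite /sextic !hornerE => /eqP.
  by rewrite -subr_eq0 => /eqP e; rewrite -[RHS]e /=; field.
(* The points 2 and 3 give independent linear equations in [c1 - c5] and [c4 - c2]. *)
have h2 := h 2%:R; have h3 := h 3%:R.
rewrite !pnatr_eq0 /= in h2 h3; have {}h2 := h2 isT; have {}h3 := h3 isT.
by split; lra.
Qed.

(** A palindromic sextic [p] satisfies [x^6 p(x^-1) = p(x)]. *)
Lemma sextic_root_inv c1 c2 c3 (x : C) : x != 0 ->
  root (map_poly (real_complex R) (sextic c1 c2 c3 c2 c1)) x ->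
  root (map_poly (real_complex R) (sextic c1 c2 c3 c2 c1)) x^-1.
Proof.
move=> x0; rewrite /sextic !rmorphD !rmorphN /= !map_polyZ.
rewrite !map_polyXn map_polyX rmorph1 !rootE !hornerE /= => /eqP e.
apply/eqP; apply: (mulfI (expf_neq0 6 x0)); rewrite mulr0 -[RHS]e.
by field.
Qed.

Lemma SL3_reversible_char_poly (g : SL R 3) : exists c1 c2 c3 c4 c5,
  char_poly (Phi (val g)) = map_poly (real_complex R) (sextic c1 c2 c3 c4 c5)
  /\ (reversible g <-> c5 = c1 /\ c4 = c2).
Proof.
have [S [T [S0 e tT cT]]] := trigonalize (val g).
have g1 : detH (val g) = 1 := eqP (SL_valP g).
have T1 : detH T = 1.
  by apply: (mulIf S0); rewrite -detHM -e detHM g1 mulr1 mul1r.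
have chi : char_poly (Phi (val g)) = char_poly (Phi T).
  by apply: (char_poly_intertwined S0); rewrite -!PhiM e.
have chiE := char_poly_Phi_trig tT cT.
have [|c1 [c2 [c3 [c4 [c5 cE]]]]] := @sextic_of_quadratics
  (qr (T 0 0) *+ 2) (qr (T 1 1) *+ 2) (qr (T 2%:R 2%:R) *+ 2)
  (sqnormq (T 0 0)) (sqnormq (T 1 1)) (sqnormq (T 2%:R 2%:R)).
  (* The product of the square norms is [detH T], which is 1. *)
  by move: T1; rewrite detH_trig // prod_ord3 => -[].
have pE : char_poly (Phi T) = map_poly (real_complex R) (sextic c1 c2 c3 c4 c5).
  rewrite chiE prod_ord3 !real_quadratic // -!rmorphM; congr (map_poly _ _).
  exact: cE.
exists c1, c2, c3, c4, c5; split; first by rewrite chi.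
rewrite reversibleP; split.
  move=> [h gh]; apply: (@sextic_reverse_coef _ _ c3) => x x0.
  have h1 : \det (Phi (val h)) != 0.
    by rewrite -/(detH _) (eqP (SL_valP h)) oner_neq0.
  have gh' : Phi (val g) *m Phi (val h) *m Phi (val g) = Phi (val h).
    by rewrite -!PhiM gh.
  have x0' : x%:C%C != 0 :> C.
    by rewrite -(rmorph0 (real_complex R)) (inj_eq (@complexI R)).
  (* At a real point the identity descends to real numbers, and [(- x)^6 = x^6]. *)
  have := char_poly_reverse h1 g1 gh' x0'.
  rewrite chi pE -(fmorphV (real_complex R)) !horner_map /=.
  rewrite -(rmorphN (real_complex R)) -rmorphXn -rmorphM => /complexI ->.
  by rewrite exprNn -signr_odd /= expr0 mul1r.
move=> [e5 e4]; subst c5 c4.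
have [U [T' [X [U0 eU X0 eX]]]] : exists S T' X,
    [/\ detH S != 0, S *m T = T' *m S, detH X != 0 & T' *m X *m T' = X].
  apply: trig_reversible => // i.
  set l := cpart1 (T i i).
  have l0 : l != 0.
    have Tii : T i i != 0.
      have : \prod_k sqnormq (T k k) != 0.
        by move: T1; rewrite detH_trig // => -[->]; exact: oner_neq0.
      by move/prodf_neq0/(_ i isT); rewrite sqnormq_eq0.
    apply: contra_neq Tii => l0; apply: quat_eq; last by rewrite cT.
    by rewrite -/l l0.
  (* By palindromicity the inverse of a root is a root, hence some diagonal entry of [T] or its
     conjugate. *)
  have : root (char_poly (Phi T)) l^-1.
    rewrite pE; apply: sextic_root_inv => //; rewrite -pE chiE rootE.
    by rewrite horner_prod (bigD1 i) //= hornerM hornerXsubC subrr !mul0r.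
  rewrite chiE rootE horner_prod => /prodf_eq0/=[k _].
  rewrite hornerM !hornerXsubC mulf_eq0 !subr_eq0 => /orP[]/eqP lk; exists k.
    by left; rewrite -lk divff.
  by right; rewrite -lk divff.
apply: (@SL_reverser_conj _ _ g (U *m S) T' X _ _ X0 eX).
  by rewrite detHM; apply: mulf_neq0; [exact: U0|exact: S0].
by rewrite -mulmxA e !mulmxA eU.
Qed.

End CharPoly.

Theorem corollary1p2 (R : realType) (u : PSL R 3) (g : SL R 3)
    (hg : \pi_(PSL R 3) g = u) :
  exists c1 c2 c3 c4 c5 : R,
    char_poly (Phi (val g)) =
      map_poly (real_complex R)
        ('X^6 - c5 *: 'X^5 + c4 *: 'X^4 - c3 *: 'X^3 + c2 *: 'X^2 - c1 *: 'X + 1)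
    /\ (reversible g <-> c5 = c1 /\ c4 = c2).
Proof. exact: SL3_reversible_char_poly. Qed.
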